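(* For every $A\in\mathcal{X}$, the function $k_A(x,y):=\mathbf{1}_A(x)\mathbf{1}_A(y)$ is a kernel on $\mathbb{X}$ such that, for all random probability measures $\tilde P_1,\tilde P_2$ on $\mathbb{X}$ defined on the same probability space (with $\mathrm{Var}_{k_A}(\tilde P_i)>0$ for $i=1,2$, so that the kernel correlation is defined), $\mathrm{Corr}_{k_A}(\tilde P_1,\tilde P_2)=\mathrm{Corr}\big(\tilde P_1(A),\tilde P_2(A)\big)$.
   Context: $\mathbb{X}$ is a locally compact Polish space with Borel $\sigma$-algebra $\mathcal{X}$. $\mathcal{P}(\mathbb{X})$ is the set of probability measures on $\mathbb{X}$, with the $\sigma$-algebra generated by the evaluation maps $\xi\mapsto\xi(A)$, $A\in\mathcal{X}$. A kernel on $\mathbb{X}$ is a measurable function $k:\mathbb{X}\times\mathbb{X}\to\mathbb{R}$ that is bounded, symmetric and positive-definite ($\sum_{i,j=1}^m a_ia_jk(x_i,x_j)\ge 0$ for all $m$, $x_i\in\mathbb{X}$, $a_i\in\mathbb{R}$). $\mathbb{H}_k$ is its reproducing kernel Hilbert space. The kernel mean embedding of $P\in\mathcal{P}(\mathbb{X})$ is $\mu_k(P)\in\mathbb{H}_k$, $\mu_k(P)(y)=\int k(x,y)\,dP(x)$; it satisfies $\langle\mu_k(P_1),\mu_k(P_2)\rangle_{\mathbb{H}_k}=\iint k\,dP_1\,dP_2$. A random probability is a random element of $\mathcal{P}(\mathbb{X})$. $\mathrm{Cov}_k(\tilde P_1,\tilde P_2)=\mathbb{E}\big[\langle\mu_k(\tilde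 P_1)-\mathbb{E}[\mu_k(\tilde P_1)],\mu_k(\tilde P_2)-\mathbb{E}[\mu_k(\tilde P_2)]\rangle_{\mathbb{H}_k}\big]$, where the expectation of an $\mathbb{H}_k$-valued random element $V$ is characterised by $\langle h,\mathbb{E}[V]\rangle=\mathbb{E}\langle h,V\rangle$ for all $h\in\mathbb{H}_k$. $\mathrm{Var}_k(\tilde P)=\mathrm{Cov}_k(\tilde P,\tilde P)$, and when both kernel variances are positive, $\mathrm{Corr}_k(\tilde P_1,\tilde P_2)=\mathrm{Cov}_k(\tilde P_1,\tilde P_2)/\big(\sqrt{\mathrm{Var}_k(\tilde P_1)}\sqrt{\mathrm{Var}_k(\tilde P_2)}\big)$. $\mathrm{Corr}$ without subscript is Pearson's correlation of real random variables. *)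

(* Defs.v *)
From HB Require Import structures.
From mathcomp Require Import all_boot all_order all_algebra.
From mathcomp Require Import all_classical all_reals all_analysis.

Set Implicit Arguments.
Unset Strict Implicit.
Unset Printing Implicit Defensive.

Import Order.TTheory GRing.Theory Num.Theory.
Import numFieldNormedType.Exports.

Local Open Scope classical_set_scope.
Local Open Scope ring_scope.

(* The type [completePseudoMetricType R] supplies a complete compatible
   metric once the space is Hausdorff, and a distinguished point (there is no
   probability measure on the empty space). *)
Definition locally_compact_polish (R : realType)
    (X : completePseudoMetricType R) : Prop :=
  [/\ hausdorff_space X,
      exists2 D : set X, countable D & dense D
    & locally_compact [set: X]].

Definition borel (T : ptopologicalType) : measurableType (@open T).-sigma :=
  g_sigma_algebraType (@open T).

Section kernels.
Context (R : realType) (d : measure_display) (X : measurableType d).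

Definition is_kernel (k : X -> X -> R) : Prop :=
  [/\ measurable_fun [set: X * X] (fun z => k z.1 z.2),
      exists M : R, forall x y, `|k x y| <= M,
      forall x y, k x y = k y x
    & forall (m : nat) (a : 'I_m -> R) (x : 'I_m -> X),
        0 <= \sum_(i < m) \sum_(j < m) a i * a j * k (x i) (x j)].

Definition indic_kernel (A : set X) (x y : X) : R := \1_A x * \1_A y.

(* Only the values of [hdot] on [hcar] are meaningful. *)
Record fun_space := FunSpace {
  hcar : set (X -> R);
  hdot : (X -> R) -> (X -> R) -> R }.

HB.instance Definition _ := gen_eqMixin fun_space.
HB.instance Definition _ := gen_choiceMixin fun_space.

Definition hnorm (H : fun_space) (f : X -> R) : R := Num.sqrt (hdot H f f).

Definition complete_fun_space (H : fun_space) : Prop :=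
  forall u : nat -> X -> R, (forall n, hcar H (u n)) ->
    (forall e : R, 0 < e -> exists N : nat, forall m n : nat,
       (N <= m)%N -> (N <= n)%N -> hnorm H (u m \- u n) < e) ->
    exists2 f, hcar H f & hnorm H (u n \- f) @[n --> \oo] --> (0 : R).

Record is_hilbert (H : fun_space) : Prop := IsHilbert {
  hilbert_0 : hcar H (cst 0);
  hilbert_lin : forall (a : R) f g,
    hcar H f -> hcar H g -> hcar H (a \*o f \+ g);
  hilbert_dotC : forall f g, hcar H f -> hcar H g -> hdot H f g = hdot H g f;
  hilbert_dot_lin : forall (a : R) f g h, hcar H f -> hcar H g -> hcar H h ->
    hdot H (a \*o f \+ g) h = a * hdot H f h + hdot H g h;
  hilbert_dot_gt0 : forall f, hcar H f -> f <> cst 0 -> 0 < hdot H f f;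
  hilbert_complete : complete_fun_space H }.

Record is_rkhs (k : X -> X -> R) (H : fun_space) : Prop := IsRkhs {
  rkhs_hilbert : is_hilbert H;
  rkhs_section : forall x, hcar H (k x);
  rkhs_reproducing : forall f x, hcar H f -> f x = hdot H f (k x) }.

(* By the Moore-Aronszajn theorem [is_rkhs k] has a solution for every kernel
   [k], whose carrier and inner product on the carrier are unique. *)
Definition rkhs (k : X -> X -> R) : fun_space :=
  xget (FunSpace [set cst 0] (fun _ _ => 0)) [set H | is_rkhs k H].

Definition mean_embedding (k : X -> X -> R) (Q : probability X R) : X -> R :=
  fun y => \int[Q]_x k x y.

Section random_elements.
Context (d' : measure_display) (Omega : measurableType d')
  (P : probability Omega R).

Definition is_hmean (H : fun_space) (V : Omega -> X -> R) (v : X -> R) : Prop :=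
  hcar H v /\
  forall h, hcar H h ->
    P.-integrable setT (fun w => (hdot H h (V w))%:E) /\
    (hdot H h v)%:E = 'E_P[fun w => hdot H h (V w)]%E.

Definition hmean (H : fun_space) (V : Omega -> X -> R) : X -> R :=
  xget (cst 0) [set v | is_hmean H V v].

(* Random probabilities on [X]: [pprobability X R] carries the sigma-algebra
   generated by the evaluation maps. *)
Definition random_probability := {mfun Omega >-> pprobability X R}.

Definition kembed (k : X -> X -> R) (Q : random_probability) :
    Omega -> X -> R :=
  fun w => mean_embedding k (Q w).

Definition kcov (k : X -> X -> R) (Q1 Q2 : random_probability) : R :=
  let H := rkhs k in
  let centered (Q : random_probability) w :=
    kembed k Q w \- hmean H (kembed k Q) in
  fine 'E_P[fun w => hdot H (centered Q1 w) (centered Q2 w)]%E.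

Definition kvar (k : X -> X -> R) (Q : random_probability) : R := kcov k Q Q.

Definition kcorr (k : X -> X -> R) (Q1 Q2 : random_probability) : R :=
  kcov k Q1 Q2 / (Num.sqrt (kvar k Q1) * Num.sqrt (kvar k Q2)).

Definition pearson (Y1 Y2 : Omega -> R) : R :=
  fine (covariance P Y1 Y2) /
    (Num.sqrt (fine 'V_P[Y1]%E) * Num.sqrt (fine 'V_P[Y2]%E)).

Definition random_mass (Q : random_probability) (A : set X) : Omega -> R :=
  fun w => fine (Q w A).

End random_elements.
End kernels.

(* Main.v *)
(* The RKHS of [k_A] is the line spanned by [\1_A], in which [\1_A] is a unit
   vector when [A] is nonempty. The mean embedding of [Q] is [Q(A) \1_A], so the
   kernel covariance is the ordinary covariance of the masses of [A]. When
   [A = set0] the kernel variances vanish, against the hypothesis. *)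
Require Import Defs.
From mathcomp Require Import all_boot all_order all_algebra.
From mathcomp Require Import all_classical all_reals all_analysis.
From mathcomp Require Import measurable_realfun.

Set Implicit Arguments.
Unset Strict Implicit.
Unset Printing Implicit Defensive.

Import Order.TTheory GRing.Theory Num.Theory.
Import numFieldNormedType.Exports.

Local Open Scope classical_set_scope.
Local Open Scope ring_scope.

Section hilbert_function_space.
Context (R : realType) (d : measure_display) (X : measurableType d).
Context (H : fun_space R X) (hH : is_hilbert H).

Lemma hdot0l (h : X -> R) : hcar H h -> hdot H (cst 0) h = 0.
Proof.
move=> Hh; have H0 := hilbert_0 hH.
have := hilbert_dot_lin hH 1 H0 H0 Hh.
have -> : (1 : R) \*o cst 0 \+ cst 0 = cst 0 :> (X -> R).
  by apply/funext => x /=; rewrite mulr0 addr0.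
by rewrite mul1r => /eqP; rewrite -subr_eq subrr eq_sym => /eqP.
Qed.

Lemma hcarZ (a : R) (f : X -> R) : hcar H f -> hcar H (a \*o f).
Proof.
move=> Hf; have -> : a \*o f = a \*o f \+ cst 0.
  by apply/funext => x /=; rewrite addr0.
exact: hilbert_lin hH a _ _ Hf (hilbert_0 hH).
Qed.

Lemma hdotZl (a : R) (f h : X -> R) : hcar H f -> hcar H h ->
  hdot H (a \*o f) h = a * hdot H f h.
Proof.
move=> Hf Hh; have -> : a \*o f = a \*o f \+ cst 0.
  by apply/funext => x /=; rewrite addr0.
by rewrite (hilbert_dot_lin hH a Hf (hilbert_0 hH) Hh) hdot0l// addr0.
Qed.

Lemma hdotZr (a : R) (f h : X -> R) : hcar H f -> hcar H h ->
  hdot H f (a \*o h) = a * hdot H f h.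
Proof.
move=> Hf Hh; rewrite (hilbert_dotC hH)//; last exact: hcarZ.
by rewrite hdotZl// (hilbert_dotC hH).
Qed.

(** The difference [w] of [v] and [u] lies in the carrier, so it may be tested against itself; it is
    then self-orthogonal, hence zero by definiteness. *)
Lemma hdot_inj (u v : X -> R) : hcar H u -> hcar H v ->
  (forall h, hcar H h -> hdot H h u = hdot H h v) -> u = v.
Proof.
move=> Hu Hv uv; pose w := (-1 : R) \*o u \+ v.
have Hw : hcar H w by exact: hilbert_lin hH _ _ _ Hu Hv.
have w0 : hdot H w w = 0.
  rewrite {1}/w (hilbert_dot_lin hH _ Hu Hv Hw) mulN1r.
  by rewrite (hilbert_dotC hH Hu Hw) (hilbert_dotC hH Hv Hw) uv// addNr.
have {}w0 : w = cst 0.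
  by apply: contrapT => /(hilbert_dot_gt0 hH Hw); rewrite w0 ltxx.
apply/funext => x; have := congr1 (fun f => f x) w0; rewrite /w/= mulN1r.
by move/eqP; rewrite addrC subr_eq0 => /eqP.
Qed.

Context (d' : measure_display) (Omega : measurableType d')
  (P : probability Omega R).

(** Pairing with [h] turns [Y w \*o e] into the scalar [Y w] times a constant, so the weak mean
    reduces to the mean of [Y]. Weak means are unique by [hdot_inj], so [xget] must return this
    one. *)
Lemma hmean_scale (Y : Omega -> R) (e : X -> R) : hcar H e ->
  P.-integrable setT (EFin \o Y) ->
  hmean P H (fun w => Y w \*o e) = fine 'E_P[Y]%E \*o e.
Proof.
move=> He iY.
have mean_Ye : is_hmean P H (fun w => Y w \*o e) (fine 'E_P[Y]%E \*o e).
  split; first exact: hcarZ.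
  move=> h Hh.
  have -> : (fun w => hdot H h (Y w \*o e)) = hdot H h e \o* Y.
    by apply/funext => w /=; rewrite hdotZr.
  split.
    have := integrableZr measurableT (hdot H h e) iY.
    by apply: eq_integrable => // w _ /=; rewrite hdotZr// -EFinM.
  have LY : Y \in Lfun P 1 by exact/Lfun1_integrable.
  rewrite hdotZr// expectationZl// EFinM fineK ?expectation_fin_num//.
  by rewrite muleC.
apply: xget_unique => // v [Hv vE]; apply: hdot_inj => // [|h Hh].
  exact: hcarZ.
apply: EFin_inj; rewrite (vE _ Hh).2.
by have [_ /(_ h Hh)[_ ->]] := mean_Ye.
Qed.

End hilbert_function_space.

Section indicator_kernel.
Context (R : realType) (d : measure_display) (X : measurableType d).
Context (A : set X).

Lemma indic_kernel_is_kernel : measurable A -> is_kernel (indic_kernel R A).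
Proof.
move=> mA; split.
- apply: measurable_funM.
    exact: measurableT_comp (measurable_indic mA) measurable_fst.
  exact: measurableT_comp (measurable_indic mA) measurable_snd.
- exists 1 => x y; rewrite /indic_kernel !indicE.
  by case: (x \in A); case: (y \in A);
    rewrite /= ?mulr1 ?mulr0 ?normr1 ?normr0.
- by move=> x y; rewrite /indic_kernel mulrC.
(* The quadratic form of a rank-one kernel is a perfect square. *)
- move=> m a x; set s := \sum_(i < m) a i * \1_A (x i).
  suff -> : \sum_(i < m) \sum_(j < m) a i * a j * indic_kernel R A (x i) (x j)
      = s ^+ 2 by exact: sqr_ge0.
  rewrite expr2 /s mulr_suml; apply: eq_bigr => i _.
  by rewrite mulr_sumr; apply: eq_bigr => j _; rewrite /indic_kernel mulrACA.
Qed.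

(* For [x0] in [A], evaluation at [x0] identifies the line spanned by [\1_A]
   with [R]; the definition also covers [A = set0], where the carrier is [{0}]. *)
Definition indic_line (x0 : X) : fun_space R X :=
  FunSpace [set f | forall x, f x = f x0 * \1_A x] (fun f g => f x0 * g x0).

Lemma indic_line_rkhs (x0 : X) : (A !=set0 -> A x0) ->
  is_rkhs (indic_kernel R A) (indic_line x0).
Proof.
move=> Ax0.
(* Either [A] contains [x0] and the first factor is 1, or [A] is empty and both sides vanish. The
   reproducing property rests on this identity. *)
have indic_x0 y : \1_A x0 * \1_A y = \1_A y :> R.
  rewrite !indicE; case: (boolP (y \in A)) => [|_]; last by rewrite mulr0.
  by rewrite inE => Ay; rewrite mem_set ?mul1r//; apply: Ax0; exists y.
split => /=.
- split => //=.
  + by move=> x; rewrite mul0r.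
  + by move=> a f g Hf Hg x /=; rewrite Hf Hg mulrDl mulrA.
  + by move=> f g _ _; rewrite mulrC.
  + by move=> a f g h _ _ _; rewrite mulrDl mulrA.
  + move=> f Hf f0; rewrite -expr2 exprn_even_gt0//=; apply/eqP => fx0.
    by apply: f0; apply/funext => x; rewrite Hf fx0 mul0r.
  + move=> u Hu cu.
    have hnormE f : hnorm (indic_line x0) f = `|f x0|.
      by rewrite /hnorm/= -expr2 sqrtr_sqr.
    (* Since the norm of [f] is the absolute value of [f x0], completeness is inherited from that of
       [R]. *)
    have : cauchy ((fun n => u n x0) @ \oo).
      apply: cauchy_exP => e e0.
      have [N uN] := cu e e0; exists (u N x0); exists N => // n /= Nn.
      by have := uN _ _ (leqnn N) Nn; rewrite hnormE.
    move/cauchy_cvgP; set l := lim _ => ul.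
    exists (l \*o \1_A) => [x /=|]; first by rewrite -mulrA indic_x0.
    rewrite (_ : (fun n => _) =
        (fun n => `|(u n x0 - l) * \1_A x0|)); last first.
      by apply/funext => n; rewrite hnormE/= mulrBl -Hu.
    rewrite -[X in _ --> X](normr0 R) -(mul0r (\1_A x0)) -(subrr l).
    by apply: cvg_norm; apply: cvgMl; apply: cvgB => //; exact: cvg_cst.
- by move=> x y; rewrite /indic_kernel -mulrA indic_x0.
- by move=> f x Hf; rewrite /indic_kernel (mulrC (\1_A x)) indic_x0; exact: Hf.
Qed.

End indicator_kernel.

Section indicator_covariance.
Context (R : realType) (d : measure_display) (X : measurableType d).
Context (A : set X) (mA : measurable A) (x0 : X) (Ax0 : A !=set0 -> A x0).
Context (d' : measure_display) (Omega : measurableType d')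
  (P : probability Omega R).

Let H := rkhs (indic_kernel R A).

(** [indic_line] witnesses existence, so [xget] returns a genuine RKHS. It may be another record, so
    what follows uses only the RKHS axioms. *)
Lemma indic_rkhs : is_rkhs (indic_kernel R A) H.
Proof.
apply: (xgetPex _ (P := [set H | is_rkhs _ H])).
by exists (indic_line R A x0); exact: indic_line_rkhs.
Qed.

Lemma indic_hcar : hcar H (\1_A : X -> R).
Proof.
have [hH hk _] := indic_rkhs; have [A0|nA] := pselect (A !=set0).
  have := hk x0; congr (hcar H _); apply/funext => y.
  by rewrite /indic_kernel [X in X * _]indicE mem_set ?mul1r//; exact: Ax0.
have -> : \1_A = cst 0 :> (X -> R); last exact: hilbert_0.
apply/funext => y; rewrite indicE memNset// => Ay.
by apply: nA; exists y.
Qed.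

(** For nonempty [A], [\1_A] is the kernel section at [x0], so the reproducing property evaluates
    [\1_A] there. For empty [A] both sides are 0. *)
Lemma indic_hdot : hdot H \1_A \1_A = \1_A x0 :> R.
Proof.
have [hH hk hr] := indic_rkhs; have [A0|nA] := pselect (A !=set0).
  rewrite (hr _ _ indic_hcar); congr (hdot H _ _); apply/funext => y.
  by rewrite /indic_kernel [X in X * _]indicE mem_set ?mul1r//; exact: Ax0.
have A0 : \1_A = cst 0 :> (X -> R).
  by apply/funext => y; rewrite indicE memNset// => Ay; apply: nA; exists y.
by rewrite A0 hdot0l//; exact: hilbert_0.
Qed.

Lemma random_mass_integrable (Q : random_probability R X Omega) :
  P.-integrable setT (EFin \o random_mass Q A).
Proof.
apply: measurable_bounded_integrable => //.
- by rewrite (le_lt_trans (probability_le1 P measurableT))// ltry.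
- apply: (measurable_comp measurableT) => //.
  (* Viewing [Q] as a probability kernel makes its evaluation at [A] measurable. *)
  have mQ : measurable_fun [set: Omega] (Q : Omega -> pprobability X R) by [].
  exact: (measurable_kernel (kprobability mQ) A mA).
- exists 1; split; first exact: num_real.
  move=> M M1 w _; apply: le_trans (ltW M1).
  rewrite /random_mass ger0_norm ?fine_ge0//.
  by rewrite -lee_fin fineK ?probability_le1// fin_num_measure.
Qed.

Lemma kembed_indic (Q : random_probability R X Omega) :
  kembed (indic_kernel R A) Q = fun w => random_mass Q A w \*o \1_A.
Proof.
apply/funext => w; apply/funext => y.
rewrite /kembed /mean_embedding /indic_kernel RintegralZr//=.
  by rewrite /Rintegral integral_indic// setIT.
exact: integrable_indic.
Qed.

(** The centred embeddings are the centred masses times [\1_A]; bilinearity leaves the squared norm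
    of [\1_A], which is [\1_A x0]. *)
Lemma kcov_indic (Q1 Q2 : random_probability R X Omega) :
  kcov P (indic_kernel R A) Q1 Q2 =
  fine (covariance P (random_mass Q1 A) (random_mass Q2 A)) * \1_A x0.
Proof.
have [hH _ _] := indic_rkhs; have H1 := indic_hcar; rewrite /kcov -/H !kembed_indic.
rewrite !(hmean_scale hH H1 (random_mass_integrable _)) /=.
have subZ (a b : R) : (a \*o \1_A) \- (b \*o \1_A) = (a - b) \*o \1_A :> (X -> R).
  by apply/funext => y /=; rewrite mulrBl.
rewrite covariance.unlock.
set m1 := fine 'E_P[random_mass Q1 A]%E; set m2 := fine 'E_P[random_mass Q2 A]%E.
rewrite (_ : (fun w => _) = fun w =>
    (random_mass Q1 A w - m1) * (random_mass Q2 A w - m2) * \1_A x0); last first.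
  apply/funext => w; rewrite !subZ hdotZl//; last exact: hcarZ.
  by rewrite hdotZr// indic_hdot mulrA.
rewrite indicE.
(* The factor is 0 or 1, so it leaves the expectation without any integrability argument for the
   product. *)
case: (x0 \in A) => /=; last first.
  by under eq_fun do rewrite mulr0; rewrite mulr0 expectation_cst.
by rewrite mulr1; under eq_fun do rewrite mulr1.
Qed.

End indicator_covariance.

Theorem proposition10 (R : realType) (X : completePseudoMetricType R)
    (hX : locally_compact_polish X)
    (A : set (borel X)) (mA : measurable A) :
  is_kernel (indic_kernel R A) /\
  forall (d : measure_display) (Omega : measurableType d)
      (P : probability Omega R)
      (Q1 Q2 : random_probability R (borel X) Omega),
    0 < kvar P (indic_kernel R A) Q1 ->
    0 < kvar P (indic_kernel R A) Q2 ->
    kcorr P (indic_kernel R A) Q1 Q2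
      = pearson P (random_mass Q1 A) (random_mass Q2 A).
Proof.
split; first exact: indic_kernel_is_kernel.
move=> d Omega P Q1 Q2 var1_gt0 _.
(* An element of [A] if there is one, the distinguished point of the space otherwise. *)
pose x0 : borel X := xget point A.
have Ax0 : A !=set0 -> A x0 by case=> x; exact: xgetI.
have kcovE := kcov_indic mA Ax0 P.
(* The kernel variance carries the factor [\1_A x0], so its positivity rules out the value 0. *)
have Ax01 : \1_A x0 = 1 :> R.
  move: var1_gt0; rewrite /kvar kcovE indicE.
  by case: (x0 \in A); rewrite // mulr0 ltxx.
by rewrite /kcorr /kvar !kcovE Ax01 !mulr1.
Qed.
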